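(* Let $1<p<\infty$, let $C\ge1$, and let $F$ be a separable uniformly convex $\mathcal{L}_{p,C+}$-space. Let $r_p>1$ and $\Gamma_p:[1,r_p)\to[1,\infty)$ be the stability constant and function for finite-dimensional subspaces of $\ell_p^N$ described in the context. Suppose that there exist $\eta>0$ and $\rho$ such that $(C+\eta)^2<\rho<r_p$ and $(C+\eta)\Gamma_p(\rho)<\Lambda_F$. Let $E$ be a Banach space such that $E^*$ is separable. If $Z\subseteq\mathcal{B}(E,F)$ is a closed subspace containing $\mathcal{F}(E,F)$, then $Z$ has the UBCP.
   Context: $\mathcal{B}(E,F)$ is the Banach space of bounded linear operators $E\to F$ with the operator norm, and $\mathcal{F}(E,F)$ is its subspace of bounded finite-rank operators. Uniform ball-covering property (UBCP): a Banach space $Z$ with unit sphere $S_Z$ has the UBCP if there exist $r>0$ and a sequence $(z_j)_{j\ge1}$ in $Z$ such that $S_Z\subseteq\bigcup_{j\ge1}B(z_j,r)$ and $r<\inf_{j\ge1}\|z_j\|$, where $B(z,r)$ is the open ball with center $z$ and radius $r$. By convention, if $Z=\{0\}$ (so $S_Z=\emptyset$) the UBCP assertion is regarded as trivially true. Banach–Mazur distance: $d_{BM}(X,Y)=\inf\{\|T\|\cdot\|T^{-1}\| : T:X\to Y \text{ an isomorphism}\}$, and $d_{BM}(X,Y)=\infty$ if $X,Y$ are not isomorphic. $\mathcal{L}_{p,C+}$-space ($1<p<\infty$, $C\ge1$): a Banach space $F$ such that for every $\varepsilon>0$ and every finite-dimensional subspace $H\subseteq F$ there is a finite-dimensional subspace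 $G\subseteq F$ with $H\subseteq G$ and $d_{BM}(G,\ell_p^{\dim G})<C+\varepsilon$. The pair $(r_p,\Gamma_p)$: $r_p>1$ and $\Gamma_p:[1,r_p)\to[1,\infty)$ is a nondecreasing function with $\lim_{r\downarrow1}\Gamma_p(r)=1$, having the following property: if $N\in\mathbb{N}$, $Y$ is a subspace of $\ell_p^N$, and $d_{BM}(Y,\ell_p^{\dim Y})<r<r_p$, then there is a projection $P:\ell_p^N\to Y$ onto $Y$ with $\|P\|\le\Gamma_p(r)$. Modulus of convexity: $\delta_F(\varepsilon)=\inf\{1-\|\frac{x+y}{2}\| : x,y\in F,\ \|x\|\le1,\ \|y\|\le1,\ \|x-y\|\ge\varepsilon\}$ for $0<\varepsilon\le2$; $F$ is uniformly convex iff $\delta_F(\varepsilon)>0$ for all $0<\varepsilon\le2$. The constant $\Lambda_F$: for uniformly convex $F$, $0<\eta<1$, $\Delta=\delta_F(\eta)$ and $0<t<\Delta/4$, put $\alpha_F(\eta,t)=\min\{\frac{\Delta}{4},\ \frac{\Delta}{2}-t,\ \frac{t(1-\eta)}{2}\}>0$, and define $\Lambda_F=1+\sup\{\alpha_F(\eta,t): 0<\eta<1,\ 0<t<\delta_F(\eta)/4\}$, so that $\Lambda_F>1$. (The $\eta$ in this definition is a bound variable unrelated to the $\eta$ in the claim.) *)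

(* Defs.v *)
(* All Banach spaces are over the reals. *)
From HB Require Import structures.
From mathcomp Require Export all_boot all_order all_algebra.
From mathcomp Require Export all_classical all_reals all_analysis.
From mathcomp Require Import ring.
Export Order.TTheory GRing.Theory Num.Theory.
Export numFieldNormedType.Exports.

Set Implicit Arguments.
Unset Strict Implicit.
Unset Printing Implicit Defensive.

Global Open Scope classical_set_scope.
Global Open Scope ring_scope.

Section SubNormed.
Context {R : realType} {V : normedModType R} (S : submodClosed V).

(* A linear subspace of V is a predicate S : submodClosed V; sub_nmod S is S
   seen as a space of its own, with the norm inherited from V. *)
Record sub_nmod : Type := SubNmod { sub_val : V; _ : sub_val \in S }.

HB.instance Definition _ := [isSub for sub_val].
HB.instance Definition _ := [Choice of sub_nmod by <:].
HB.instance Definition _ := [SubChoice_isSubLmodule of sub_nmod by <:].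

Let sub_norm (x : sub_nmod) : R := `|sub_val x|.

Let ler_sub_normD (x y : sub_nmod) : sub_norm (x + y) <= sub_norm x + sub_norm y.
Proof. by rewrite /sub_norm /= ler_normD. Qed.

Let sub_normZ (a : R) (x : sub_nmod) : sub_norm (a *: x) = `|a| * sub_norm x.
Proof. by rewrite /sub_norm /= normrZ. Qed.

Let sub_norm0 (x : sub_nmod) : sub_norm x = 0 -> x = 0.
Proof. by move=> /normr0_eq0 x0; apply/val_inj. Qed.

HB.instance Definition _ :=
  Lmodule_isNormed.Build R sub_nmod ler_sub_normD sub_normZ sub_norm0.

End SubNormed.

Section BoundedOperators.
Context {R : realType} {E F : normedModType R}.

Definition bounded_operator : {pred E -> F} :=
  mem [set f : E -> F | linear f /\ exists M, forall x, `|f x| <= M * `|x|].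

Let bounded_operator_submod : submod_closed bounded_operator.
Proof.
split=> [|a f g].
  rewrite inE/=; split=> [b x y|]; first by rewrite scaler0 addr0.
  by exists 0 => x; rewrite normr0 mul0r.
rewrite !inE/= => -[lf [M fM]] [lg [N gN]]; split=> [b x y|].
  have comb z : (a *: f + g) z = a *: f z + g z by [].
  by rewrite !comb lf lg !scalerDr !scalerA mulrC addrACA.
exists (`|a| * M + N) => x; rewrite mulrDl -mulrA (le_trans (ler_normD _ _))//.
by rewrite lerD// normrZ ler_wpM2l.
Qed.

HB.instance Definition _ :=
  GRing.isSubmodClosed.Build R (E -> F) bounded_operator bounded_operator_submod.

Record Bop : Type := BOp { bop_fun :> E -> F; _ : bop_fun \in bounded_operator }.

HB.instance Definition _ := [isSub for bop_fun].
HB.instance Definition _ := [Choice of Bop by <:].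
HB.instance Definition _ := [SubChoice_isSubLmodule of Bop by <:].

Definition opnorm (T : Bop) : R := sup [set `|T x| | x in [set x : E | `|x| <= 1]].

Lemma bop_linear (T : Bop) : linear T.
Proof. by case: T => f /=; rewrite inE => -[]. Qed.

Lemma bop_bounded (T : Bop) : exists M, forall x, `|T x| <= M * `|x|.
Proof. by case: T => f /=; rewrite inE => -[]. Qed.

HB.instance Definition _ (T : Bop) :=
  GRing.isLinear.Build R E F _ (T : E -> F) (bop_linear T).

Lemma opnorm_has_ubound (T : Bop) :
  has_ubound [set `|T x| | x in [set x : E | `|x| <= 1]].
Proof.
have [M TM] := bop_bounded T; exists `|M| => _ [x /= x1 <-].
rewrite (le_trans (TM x))// (le_trans (ler_norm _))// normrM normr_id.
by rewrite ler_piMr.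
Qed.

Lemma opnorm_nonempty (T : Bop) :
  [set `|T x| | x in [set x : E | `|x| <= 1]] !=set0.
Proof. by exists `|T 0|, 0 => //=; rewrite normr0. Qed.

Lemma opnorm_ball (T : Bop) x : `|x| <= 1 -> `|T x| <= opnorm T.
Proof. by move=> x1; apply: (ub_le_sup (opnorm_has_ubound T)); exists x. Qed.

Lemma opnorm_le (T : Bop) M :
  (forall x, `|x| <= 1 -> `|T x| <= M) -> opnorm T <= M.
Proof.
by move=> TM; apply: (ge_sup (opnorm_nonempty T)) => _ [x x1 <-]; exact: TM.
Qed.

Lemma opnorm_ge0 (T : Bop) : 0 <= opnorm T.
Proof. by rewrite (le_trans _ (@opnorm_ball T 0 _)) ?normr0. Qed.

Lemma ler_opnorm (T : Bop) x : `|T x| <= opnorm T * `|x|.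
Proof.
have [->|x0] := eqVneq x 0; first by rewrite linear0 !normr0 mulr0.
have -> : `|T x| = `|T (`|x|^-1 *: x)| * `|x|.
  by rewrite linearZ/= normrZ normfV normr_id mulrAC mulVf ?mul1r ?normr_eq0.
by rewrite ler_wpM2r// opnorm_ball// normfZV.
Qed.

Let ler_opnormD (S T : Bop) : opnorm (S + T) <= opnorm S + opnorm T.
Proof.
apply: opnorm_le => x x1; rewrite (le_trans (ler_normD _ _))//.
by rewrite lerD// opnorm_ball.
Qed.

Let opnormZ_le (a : R) (T : Bop) : opnorm (a *: T) <= `|a| * opnorm T.
Proof.
by apply: opnorm_le => x x1; rewrite normrZ ler_wpM2l// opnorm_ball.
Qed.

Let opnormZ (a : R) (T : Bop) : opnorm (a *: T) = `|a| * opnorm T.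
Proof.
apply/eqP; rewrite eq_le opnormZ_le/=.
have [->|a0] := eqVneq a 0; first by rewrite normr0 mul0r opnorm_ge0.
rewrite mulrC -ler_pdivlMr ?normr_gt0// mulrC -normfV.
by rewrite (le_trans _ (opnormZ_le _ _))// scalerA mulVf// scale1r.
Qed.

Let opnorm0_eq0 (T : Bop) : opnorm T = 0 -> T = 0.
Proof.
move=> T0; apply/val_inj/funext => x; apply/normr0_eq0/eqP.
by rewrite eq_le normr_ge0 andbT (le_trans (ler_opnorm T x))// T0 mul0r.
Qed.

HB.instance Definition _ :=
  Lmodule_isNormed.Build R Bop ler_opnormD opnormZ opnorm0_eq0.

End BoundedOperators.
Arguments Bop {R} E F.

Definition dual {R : realType} (E : normedModType R) : normedModType R :=
  Bop E R^o.

Definition has_dim {R : realType} (V : lmodType R) (n : nat) : Prop :=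
  inhabited (Vector.axiom n V).

Definition finite_dim {R : realType} (V : lmodType R) : Prop :=
  exists n, has_dim V n.

Section Range.
Context {R : realType} {E F : normedModType R} (T : Bop E F).

Definition bop_range : {pred F} := mem (range T).

Let bop_range_submod : submod_closed bop_range.
Proof.
split=> [|a y z]; rewrite !inE/=; first by exists 0 => //; rewrite linear0.
by move=> -[x _ <-] [x' _ <-]; exists (a *: x + x') => //; rewrite linearP.
Qed.

HB.instance Definition _ :=
  GRing.isSubmodClosed.Build R F bop_range bop_range_submod.

Definition finite_rank : Prop := finite_dim (sub_nmod bop_range).

End Range.

Lemma powR_conv_le (R : realType) (p a b u v : R) : 1 <= p -> 0 < a -> 0 < b ->
  0 <= u -> 0 <= v ->
  (u + v) `^ p <= (a + b) `^ p *
    (a / (a + b) * (u `^ p / a `^ p) + b / (a + b) * (v `^ p / b `^ p)).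
Proof.
move=> p1 a0 b0 u0 v0.
have ab0 : 0 < a + b by rewrite addr_gt0.
have c0 : 0 <= a / (a + b) by rewrite divr_ge0 ?ltW.
have c1 : a / (a + b) <= 1 by rewrite ler_pdivrMr// mul1r lerDl ltW.
have cb : 1 - a / (a + b) = b / (a + b) by field; rewrite gt_eqF.
have div (w d : R) : 0 <= w -> 0 < d -> w `^ p / d `^ p = (w / d) `^ p.
  move=> w0 d0; rewrite powRM ?invr_ge0 ?(ltW d0)//.
  by rewrite -[d^-1](powR_inv1 (ltW d0)) -powRrM mulN1r powRN.
have ge0 (w d : R) : 0 <= w -> 0 < d -> w / d \in (`[0, +oo[%classic : set R).
  by move=> w0 d0; rewrite inE/= in_itv/= andbT divr_ge0// ltW.
have := @convex_powR R p p1 (Itv01 c0 c1) _ _ (ge0 _ _ u0 a0) (ge0 _ _ v0 b0).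
move=> h; rewrite convRE [X in X `^ _ <= _]convRE /= /unstable.onem cb in h.
rewrite !div//.
apply: le_trans (ler_wpM2l (powR_ge0 _ _) h); rewrite -powRM ?(ltW ab0)//.
  rewrite (_ : (a + b) * _ = u + v)//.
  by field; rewrite !gt_eqF.
by rewrite addr_ge0// mulr_ge0// divr_ge0// ltW.
Qed.

Section Ellp.
Context {R : realType} {p : R} (p1 : 1 < p) (n : nat).

(* The index p1 attaches the p-norm to the type; it replaces the max norm
   which the library puts on row vectors. *)
Definition ellp of 1 < p : Type := 'rV[R]_n.
Local Notation ellpn := (ellp p1).

HB.instance Definition _ := GRing.Lmodule.copy ellpn 'rV[R]_n.

Definition ellp_norm (x : ellpn) : R :=
  (\sum_(i < n) `|(x : 'rV[R]_n) ord0 i| `^ p) `^ p^-1.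

Let p0 : 0 < p. Proof. exact: lt_trans p1. Qed.

Let pn0 : p != 0. Proof. by rewrite gt_eqF. Qed.

Let ellp_normK (x : ellpn) :
  ellp_norm x `^ p = \sum_(i < n) `|(x : 'rV[R]_n) ord0 i| `^ p.
Proof.
rewrite /ellp_norm -powRrM mulVf// powRr1// sumr_ge0// => i _.
Qed.

Let ellp_norm0_eq0 (x : ellpn) : ellp_norm x = 0 -> x = 0.
Proof.
move=> x0; have /eqP := ellp_normK x; rewrite x0 powR0// eq_sym.
rewrite psumr_eq0; last by move=> i _; exact: powR_ge0.
move=> /allP h; apply/rowP => i; rewrite mxE.
have /(_ (mem_index_enum i)) := h i; rewrite /= => /eqP/powR_eq0_eq0.
by move/normr0_eq0.
Qed.

Let ellp_normZ (a : R) (x : ellpn) : ellp_norm (a *: x) = `|a| * ellp_norm x.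
Proof.
rewrite /ellp_norm; under eq_bigr do rewrite mxE normrM powRM//.
rewrite -mulr_sumr powRM ?powR_ge0//; last first.
  by apply: sumr_ge0 => i _; exact: powR_ge0.
by rewrite -powRrM mulfV// powRr1.
Qed.

Let ler_ellp_normD (x y : ellpn) :
  ellp_norm (x + y) <= ellp_norm x + ellp_norm y.
Proof.
have [/ellp_norm0_eq0 ->|x0] := eqVneq (ellp_norm x) 0.
  by rewrite add0r lerDr powR_ge0.
have [/ellp_norm0_eq0 ->|y0] := eqVneq (ellp_norm y) 0.
  by rewrite addr0 lerDl powR_ge0.
have a0 : 0 < ellp_norm x by rewrite lt_neqAle eq_sym x0 powR_ge0.
have b0 : 0 < ellp_norm y by rewrite lt_neqAle eq_sym y0 powR_ge0.
move: (ellp_normK x) (ellp_normK y).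
rewrite {3}/ellp_norm; move: (ellp_norm x) (ellp_norm y) a0 b0 => a b a0 b0 {x0 y0}.
move=> xa yb; set s := \sum_(i < n) _.
have ab0 : 0 < a + b by rewrite addr_gt0.
have s0 : 0 <= s by apply: sumr_ge0 => i _; exact: powR_ge0.
suff le1 : s <= (a + b) `^ p.
  rewrite -[leRHS](powRr1 (ltW ab0)) -(mulfV pn0) powRrM.
  by rewrite ge0_ler_powR ?invr_ge0 ?(ltW p0)// nnegrE powR_ge0.
have key (i : 'I_n) : `|(x + y : 'rV[R]_n) ord0 i| `^ p <=
    (a + b) `^ p * (a / (a + b) * (`|(x : 'rV[R]_n) ord0 i| `^ p / a `^ p) +
                    b / (a + b) * (`|(y : 'rV[R]_n) ord0 i| `^ p / b `^ p)).
  rewrite (le_trans _ (powR_conv_le (ltW p1) a0 b0 _ _))//.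
  rewrite ge0_ler_powR ?nnegrE ?(ltW p0)//.
  by rewrite mxE ler_normD.
rewrite (le_trans (ler_sum _ (fun i _ => key i)))// -mulr_sumr big_split/=.
rewrite -!mulr_sumr -!mulr_suml -xa -yb.
rewrite !divff ?powR_eq0 ?gt_eqF// !mulr1 -mulrDl divff ?gt_eqF//.
by rewrite mulr1.
Qed.

HB.instance Definition _ :=
  Lmodule_isNormed.Build R ellpn ler_ellp_normD ellp_normZ ellp_norm0_eq0.

End Ellp.

Definition separable_space (T : topologicalType) : Prop :=
  exists2 A : set T, countable A & dense A.

(* An isomorphism is given together with its inverse; the infimum over the
   empty set is +oo. *)
Definition d_BM {R : realType} (X Y : normedModType R) : \bar R :=
  ereal_inf [set (`|TS.1| * `|TS.2|)%:E | TS in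
    [set TS : Bop X Y * Bop Y X | cancel TS.1 TS.2 /\ cancel TS.2 TS.1]].

Definition Lp_plus_space {R : realType} (p : R) (p1 : 1 < p) (C : R)
    (F : normedModType R) : Prop :=
  forall (eps : R) (H : submodClosed F), 0 < eps -> finite_dim (sub_nmod H) ->
    exists (G : submodClosed F) (n : nat),
      [/\ {subset H <= G}, has_dim (sub_nmod G) n &
          (d_BM (sub_nmod G) (ellp n p1) < (C + eps)%:E)%E].

(* Gamma : [1, rp[ -> [1, +oo[ is a total function of which only the values on
   its domain matter; n is the dimension of Y. *)
Definition stability_pair {R : realType} (p : R) (p1 : 1 < p) (rp : R)
    (Gamma : R -> R) : Prop :=
  [/\ 1 < rp,
      {in `[1, rp[, forall r, 1 <= Gamma r},
      {in `[1, rp[ &, {homo Gamma : r s / r <= s}},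
      Gamma r @[r --> 1^'+] --> (1 : R) &
      forall (N n : nat) (Y : submodClosed (ellp N p1)),
        has_dim (sub_nmod Y) n ->
        {in `[1, rp[, forall r,
          (d_BM (sub_nmod Y) (ellp n p1) < r%:E)%E ->
          exists P : Bop (ellp N p1) (sub_nmod Y),
            (forall y : sub_nmod Y, P (val y) = y) /\ `|P| <= Gamma r}].

(* Extended real, because the infimum is over the empty set when F = {0}. *)
Definition convexity_modulus {R : realType} (F : normedModType R) (eps : R) :
    \bar R :=
  ereal_inf [set (1 - `|2^-1 *: (xy.1 + xy.2)|)%:E | xy in
    [set xy : F * F | [/\ `|xy.1| <= 1, `|xy.2| <= 1 & eps <= `|xy.1 - xy.2|]]].

Definition uniformly_convex {R : realType} (F : normedModType R) : Prop :=
  forall eps : R, 0 < eps <= 2 -> (0 < convexity_modulus F eps)%E.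

Definition alpha_cst {R : realType} (F : normedModType R) (eta t : R) : \bar R :=
  let Delta := convexity_modulus F eta in
  Order.min (Delta * (4^-1)%:E)%E
    (Order.min (Delta * (2^-1)%:E - t%:E)%E (t * (1 - eta) / 2)%:E).

Definition Lambda_cst {R : realType} (F : normedModType R) : \bar R :=
  (1 + ereal_sup [set a : \bar R | exists eta t : R,
    [/\ (0 < eta < 1)%R, (0 < t)%R,
        t%:E < convexity_modulus F eta * (4^-1)%:E & a = alpha_cst F eta t]])%E.

(* The library's ball in a normed module is the open ball of the norm. The
   first disjunct is the convention for the zero space. *)
Definition UBCP {R : realType} (Z : normedModType R) : Prop :=
  (forall z : Z, z = 0) \/
  exists (r : R) (z : nat -> Z),
    [/\ 0 < r,
        [set x : Z | `|x| = 1] `<=` \bigcup_j ball (z j) r &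
        r < inf (range (fun j => `|z j|))].

(* Main.v *)
Require Import Defs.
From HB Require Import structures.
From mathcomp Require Import ring lra.

Set Implicit Arguments.
Unset Strict Implicit.
Unset Printing Implicit Defensive.

(** The centers are finite-rank operators close to [s P T], where [T] runs over
    the unit sphere of [Z], [P] is a finite-rank projection of [F] and [s > 1]
    is a fixed scale.

    Why scaling helps: suppose [P] is a projection of norm at most [1 + a], and
    let [|y| <= 1].  If [y] is close to [P y / (1 + a)], then [y - s P y] is
    nearly [-(s - 1) P y], whose norm is less than [s] when [a] is small.  If it
    is far from it, uniform convexity makes the midpoint of [y] and
    [P y / (1 + a)] short; since [P] maps this midpoint to a multiple of [P y]
    close to [P y] itself, [|P y|] is bounded away from [1], and so
    [|y| + s |P y|] is less than [s] when [s] is large.  With [s = 1 / t], the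
    inequality [a <= alpha_F(eta, t)] is what both cases need, and they give
    [|y - s P y| <= s - (1 - eta) / 2] ([uniformly_convex_reflection]).  Hence
    [|T - s P T| <= s - (1 - eta) / 2], whereas [s P T] has norm almost [s] as
    soon as [P] fixes a vector [T x] with [|x| <= 1] and [|T x|] close to [1].

    Such a [P] fixing a prescribed vector [y0] of [F] exists, with norm at most
    [(C + eta) Gamma_p(rho) < Lambda_F] ([finite_rank_projection]).  The
    [L_p]-structure provides a finite-dimensional [G] containing [y0], and
    arbitrarily large finite-dimensional [G'] containing [G], both at distance
    less than [C + eta] from an [l_p^n].  The image of [G] in the [l_p^N] which
    models [G'] is within [(C + eta)^2 < rho] of [l_p^n], so the stability
    property projects [l_p^N] onto it, and thus [G'] onto [G]
    ([local_projection]).  An ultrafilter limit of these projections along the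
    growing [G'] is defined on all of [F] ([limit_projection]).

    Countably many centers suffice because [E^*] and [F] are separable: the
    finite sums of [f (x) y], with [f] and [y] in countable dense sets,
    approximate every finite-rank operator ([tensor_sum_approx]). *)

(** * Finite-dimensional subspaces *)

(** As long as the surjection kills some [v] with [v_j != 0], its restriction to
    the vectors whose [j]-th coordinate vanishes is still onto. *)
Lemma finite_dim_surj (R : realType) (V : lmodType R) (n : nat)
    (f : 'rV[R]_n -> V) :
  linear f -> (forall y, exists v, f v = y) -> finite_dim V.
Proof.
elim: n f => [|n IHn] f flin fsurj.
  exists 0%N; split; exists (fun=> 0); first by move=> a x y; rewrite scaler0 addr0.
  exists f => [y|v]; last by rewrite [RHS]thinmx0.
  by have [v <-] := fsurj y; rewrite [v]thinmx0.
pose fl : {linear 'rV[R]_n.+1 -> V} :=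
  HB.pack f (GRing.isLinear.Build R _ _ _ f flin).
have [[v [fv0 v0]]|finj] := pselect (exists v, f v = 0 /\ v != 0).
  have /rV0Pn[j vj0] := v0.
  apply: (IHn (fun u => f (u *m row' j 1%:M))).
    by move=> a x y; rewrite mulmxDl -scalemxAl flin.
  move=> y; have [w <-] := fsurj y.
  (* [w'] is the representative of [w] modulo [v] whose [j]-th entry is zero. *)
  pose w' := w - (w 0 j / v 0 j) *: v.
  have fw : f w = f w'.
    by rewrite -[f w']/(fl w') linearB linearZ /= fv0 scaler0 subr0.
  have w'j : w' 0 j = 0 by rewrite !mxE mulfVK// subrr.
  exists (col' j w'); rewrite fw; congr f; apply/rowP => i; rewrite mxE.
  rewrite (eq_bigr (fun k => w' 0 (lift j k) * (i == lift j k)%:R)); last first.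
    by move=> k _; rewrite !mxE eq_sym.
  have [k ->|->] := unliftP j i.
    rewrite (bigD1 k)//= eqxx mulr1 big1 ?addr0// => l lk.
    by rewrite (inj_eq lift_inj) eq_sym (negbTE lk) mulr0.
  rewrite w'j big1// => k _; rewrite (_ : j == _ = false) ?mulr0//.
  exact/negbTE/neq_lift.
have inj : injective f.
  move=> x y fxy; apply/eqP; rewrite -subr_eq0; apply: contrapT => /negP xy0.
  apply: finj; exists (x - y); split=> //.
  by rewrite -[f _]/(fl (x - y)) linearB /= fxy subrr.
have [g gK] := choice fsurj.
have fK : cancel f g by move=> x; apply: inj; rewrite gK.
exists n.+1; split; exists g; last by exists f.
exact: (can2_linear (f := fl)).
Qed.

(** * Bounded operators *)

Lemma bop_of_linear (R : realType) (E F : normedModType R) (f : E -> F) (M : R) :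
  linear f -> 0 <= M -> (forall x, `|f x| <= M * `|x|) ->
  exists2 T : Bop E F, (forall x, T x = f x) & `|T| <= M.
Proof.
move=> flin M0 fM.
have fb : f \in @bounded_operator R E F by rewrite inE /=; split=> //; exists M.
exists (BOp fb) => //; apply: opnorm_le => x x1.
by rewrite (le_trans (fM x))// ler_piMr.
Qed.

(** The same bound as [ler_opnorm], for the norm as the normed-module structure
    presents it: [opnorm] itself is not recognized by the lemmas about norms. *)
Lemma ler_normbop (R : realType) (E F : normedModType R) (T : Bop E F) x :
  `|T x| <= `|T| * `|x|.
Proof. exact: ler_opnorm. Qed.

Section BopConstructions.
Context {R : realType}.

Lemma bop_comp_subproof (D E F : normedModType R) (T : Bop E F) (S : Bop D E) :
  (T \o S) \in @bounded_operator R D F.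
Proof.
rewrite inE /=; split=> [a x y|]; first by rewrite /= !linearP.
exists (`|T| * `|S|) => x; rewrite (le_trans (ler_normbop T _))// -mulrA.
by rewrite ler_wpM2l// ler_normbop.
Qed.

Definition bop_comp (D E F : normedModType R) (T : Bop E F) (S : Bop D E) :
  Bop D F := BOp (bop_comp_subproof T S).

Lemma rank_one_subproof (E F : normedModType R) (f : Bop E R^o) (y : F) :
  (fun x => (f x : R) *: y) \in @bounded_operator R E F.
Proof.
rewrite inE /=; split=> [a u v|]; first by rewrite linearP scalerDl scalerA.
exists (`|f| * `|y|) => x; rewrite normrZ mulrAC ler_wpM2r//.
exact: (ler_normbop f x).
Qed.

Definition rank_one (E F : normedModType R) (f : Bop E R^o) (y : F) : Bop E F :=
  BOp (rank_one_subproof f y).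

Lemma bopBE (E F : normedModType R) (S T : Bop E F) x : (S - T) x = S x - T x.
Proof. by []. Qed.

Lemma bop_sumE (E F : normedModType R) I (r : seq I) (T : I -> Bop E F) x :
  (\sum_(i <- r) T i) x = \sum_(i <- r) T i x.
Proof. by elim/big_rec2: _ => // i y S _ <-. Qed.

Lemma bopP (E F : normedModType R) (S T : Bop E F) : (forall x, S x = T x) -> S = T.
Proof. by move=> ST; apply/val_inj/funext. Qed.

Lemma bop_norm_le (E F : normedModType R) (T : Bop E F) M :
  0 <= M -> (forall x, `|T x| <= M * `|x|) -> `|T| <= M.
Proof.
by move=> M0 TM; apply: opnorm_le => x x1; rewrite (le_trans (TM x))// ler_piMr.
Qed.

End BopConstructions.

(** * Spans and preimages as normed subspaces *)

Section LinSpan.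
Context {R : realType} {V : lmodType R}.

Definition lin_comb (s : seq V) (v : 'rV[R]_(size s)) : V :=
  \sum_(i < size s) v ord0 i *: s`_i.

Lemma lin_comb_linear s : linear (@lin_comb s).
Proof.
move=> a u v; rewrite /lin_comb scaler_sumr -big_split; apply: eq_bigr => i _.
by rewrite !mxE scalerDl scalerA.
Qed.

Definition lin_span (s : seq V) : {pred V} := mem (range (@lin_comb s)).

Lemma lin_span_submod s : submod_closed (lin_span s).
Proof.
split=> [|a x y]; rewrite !inE/=.
  exists 0 => //; rewrite /lin_comb big1// => i _.
  by rewrite mxE scale0r.
by move=> -[u _ <-] [v _ <-]; exists (a *: u + v) => //; rewrite lin_comb_linear.
Qed.

HB.instance Definition _ s :=
  GRing.isSubmodClosed.Build R V (lin_span s) (lin_span_submod s).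

Lemma mem_lin_span s x : x \in s -> x \in lin_span s.
Proof.
move=> xs; rewrite inE/=; have xi : (index x s < size s)%N by rewrite index_mem.
exists (delta_mx ord0 (Ordinal xi)) => //; rewrite /lin_comb (bigD1 (Ordinal xi))//=.
rewrite mxE !eqxx scale1r nth_index// big1 ?addr0// => i ii.
by rewrite mxE eqxx (negbTE ii) scale0r.
Qed.

End LinSpan.

Lemma finite_dim_lin_span (R : realType) (F : normedModType R) (s : seq F) :
  finite_dim (sub_nmod (lin_span s)).
Proof.
have mem v : @lin_comb R F s v \in lin_span s by rewrite inE/=; exists v.
apply: (@finite_dim_surj _ _ (size s) (fun v => SubNmod (mem v))).
  by move=> a u v; apply: val_inj; rewrite /= lin_comb_linear.
by move=> [y yP]; have /set_mem[v _ vy] := yP; exists v; apply: val_inj.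
Qed.

Section PreimSub.
Context {R : realType} {U V : lmodType R} (f : {linear U -> V}) (S : submodClosed V).

Definition preim_sub : {pred U} := [pred x | f x \in S].

Lemma preim_sub_submod : submod_closed preim_sub.
Proof.
split=> [|a x y]; rewrite !inE; first by rewrite linear0 rpred0.
by move=> xS yS; rewrite linearP rpredD// rpredZ.
Qed.

HB.instance Definition _ :=
  GRing.isSubmodClosed.Build R U preim_sub preim_sub_submod.

End PreimSub.

(** * Projections between two subspaces close to l_p *)

Lemma d_BM_lt (R : realType) (X Y : normedModType R) (k : R) :
  (d_BM X Y < k%:E)%E ->
  exists (T : Bop X Y) (S : Bop Y X),
    [/\ cancel T S, cancel S T & `|T| * `|S| < k].
Proof.
by move=> /ereal_inf_lt[_ [[T S] /= [TK SK] <-]]; rewrite lte_fin; exists T, S.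
Qed.

(** Transport through the isomorphism [T'] of [G'] with [l_p^N]: the subspace
    [Y] of [l_p^N] corresponding to [G] is within [k ^ 2] of [l_p^n], so it is
    the range of a projection [P] with [|P| <= Gamma rho], and [S' P T'] costs a
    further factor [|S'| |T'| < k].  The projection is given as a map on all of
    [F], of which only the values on [G'] are meaningful, so that the projections
    obtained for different [G'] have a common type. *)
Lemma local_projection (R : realType) (p : R) (p1 : 1 < p) (rp : R)
    (Gamma : R -> R) (F : normedModType R) (G G' : submodClosed F) (n N : nat)
    (k rho : R) :
  stability_pair p1 rp Gamma -> {subset G <= G'} ->
  1 <= k -> k ^+ 2 < rho -> rho < rp ->
  (d_BM (sub_nmod G) (ellp n p1) < k%:E)%E ->
  (d_BM (sub_nmod G') (ellp N p1) < k%:E)%E ->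
  exists Q : F -> F,
    [/\ {in G', forall y, Q y \in G},
        {in G, forall y, Q y = y},
        forall a, {in G' &, forall x y, Q (a *: x + y) = a *: Q x + Q y} &
        {in G', forall y, `|Q y| <= k * Gamma rho * `|y|}].
Proof.
move=> [_ Gamma1 _ _ stab] GG' k1 krho rhorp /d_BM_lt[T [S [TK SK TSk]]].
move=> /d_BM_lt[T' [S' [TK' SK' TSk']]].
have rho_in : rho \in `[1, rp[.
  by rewrite in_itv/= rhorp andbT (le_trans _ (ltW krho))// exprn_ege1.
pose incl : {linear sub_nmod G' -> F} := \val : sub_nmod G' -> F.
(* [S'] inverts [T'], so this preimage is the image of [G] under [T']. *)
pose Y := preim_sub (incl \o S') G.
have YG (y : sub_nmod Y) : val (S' (val y)) \in G by case: y.
pose YtoG (y : sub_nmod Y) : sub_nmod G := SubNmod (YG y).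
have GG (g : sub_nmod G) : val g \in G' by apply: GG'; case: g.
pose j (g : sub_nmod G) : sub_nmod G' := SubNmod (GG g).
have GY (g : sub_nmod G) : T' (j g) \in Y.
  by rewrite inE/= TK'/=; case: g.
pose GtoY (g : sub_nmod G) : sub_nmod Y := SubNmod (GY g).
have YtoG_lin : linear YtoG by move=> a x y; apply: val_inj; rewrite /= !linearP.
have j_lin : linear j by move=> a x y; apply: val_inj.
have GtoY_lin : linear GtoY.
  by move=> a x y; apply: val_inj; rewrite /= j_lin linearP.
have YtoGK : cancel YtoG GtoY.
  move=> y; apply: val_inj => /=; rewrite -[RHS]SK'; congr (T' _).
  exact: val_inj.
have GtoYK : cancel GtoY YtoG.
  by move=> g; apply: val_inj; rewrite /= TK'.
have [U UE Ule] : exists2 U : Bop (sub_nmod Y) (ellp n p1),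
    (forall y, U y = T (YtoG y)) & `|U| <= `|T| * `|S'|.
  apply: bop_of_linear => [a x y||y]; first by rewrite YtoG_lin linearP.
    by rewrite mulr_ge0.
  rewrite (le_trans (ler_normbop T _))// -mulrA ler_wpM2l//.
  exact: (ler_normbop S' (val y)).
have [W WE Wle] : exists2 W : Bop (ellp n p1) (sub_nmod Y),
    (forall x, W x = GtoY (S x)) & `|W| <= `|T'| * `|S|.
  apply: bop_of_linear => [a x y||x]; first by rewrite linearP GtoY_lin.
    by rewrite mulr_ge0.
  apply: le_trans (ler_normbop T' (j (S x))) _.
  by rewrite -mulrA ler_wpM2l//; exact: (ler_normbop S x).
have dimY : has_dim (sub_nmod Y) n.
  split; exists (U : sub_nmod Y -> ellp n p1); first exact: (@bop_linear _ _ _ U).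
  exists W => [y|x]; first by rewrite WE UE TK YtoGK.
  by rewrite UE WE GtoYK SK.
have [|P [PY Ple]] := stab N n Y dimY rho rho_in.
  apply: (le_lt_trans (y := (`|U| * `|W|)%:E)).
    apply: ereal_inf_lbound; exists (U, W) => //=; split=> [y|x].
      by rewrite WE UE TK YtoGK.
    by rewrite UE WE GtoYK SK.
  rewrite lte_fin (le_lt_trans _ krho)//.
  rewrite (le_trans (ler_pM _ _ Ule Wle))//.
  have -> : `|T| * `|S'| * (`|T'| * `|S|) = `|T| * `|S| * (`|T'| * `|S'|) by ring.
  by rewrite expr2 ler_pM ?mulr_ge0// ltW.
pose Q y := val (YtoG (P (T' (insubd 0 y)))).
have insubdE y : y \in G' -> val (insubd 0 y : sub_nmod G') = y.
  by move=> yG'; rewrite insubdK.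
exists Q; split=> [y yG'|y yG|a x y xG' yG'|y yG'].
- by rewrite /Q; case: (YtoG _).
- rewrite /Q (_ : T' _ = val (GtoY (SubNmod yG))); first by rewrite PY GtoYK.
  by congr (T' _); apply: val_inj; rewrite /= insubdE// GG'.
- rewrite /Q (_ : insubd 0 _ = a *: insubd 0 x + insubd 0 y); last first.
    by apply: val_inj; rewrite /= !insubdE// rpredD// rpredZ.
  by rewrite linearP linearP YtoG_lin.
- rewrite /Q /= (le_trans (ler_normbop S' _))//.
  rewrite (le_trans (ler_wpM2l (normr_ge0 S') (ler_normbop P _)))//.
  rewrite (le_trans (ler_wpM2l _ (ler_wpM2l _ (ler_normbop T' _))))//.
  have -> : `|insubd 0 y : sub_nmod G'| = `|y|.
    by rewrite -[LHS]/(`|val _|) insubdE.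
  rewrite !mulrA ler_wpM2r// mulrAC [X in X * _]mulrC.
  by rewrite ler_pM// ?mulr_ge0// ltW.
Qed.

(** * Limits of projections onto a fixed finite-dimensional subspace *)

Lemma ellp_coord_le (R : realType) (p : R) (p1 : 1 < p) (n : nat)
    (x : ellp n p1) (i : 'I_n) : `|(x : 'rV[R]_n) ord0 i| <= `|x|.
Proof.
rewrite -[leRHS]/(ellp_norm x) /ellp_norm.
have p0 : 0 < p by rewrite (lt_trans _ p1).
rewrite -[leLHS]powRr1// -(mulfV (lt0r_neq0 p0)) powRrM.
rewrite ge0_ler_powR ?invr_ge0 ?(ltW p0) ?nnegrE ?powR_ge0 ?sumr_ge0//; last first.
  by rewrite (bigD1 i)//= lerDl sumr_ge0// => j _; rewrite powR_ge0.
Qed.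

Lemma ellp_coordinates (R : realType) (p : R) (p1 : 1 < p) (n : nat)
    (X : normedModType R) (T : Bop X (ellp n p1)) (S : Bop (ellp n p1) X) :
  cancel T S ->
  exists (c : 'I_n -> Bop X R^o) (g : 'I_n -> X),
    forall x, x = \sum_(i < n) (c i x : R) *: g i.
Proof.
move=> TK.
have /choice[c cE] (i : 'I_n) :
    exists c : Bop X R^o, forall x, c x = (T x : 'rV[R]_n) ord0 i.
  have [||x|c cE _] := @bop_of_linear R X R^o
    (fun x => (T x : 'rV[R]_n) ord0 i) `|T|; last by exists c.
  - by move=> a x y; rewrite linearP !mxE.
  - by [].
  - by rewrite (le_trans (ellp_coord_le _ _))// ler_normbop.
exists c, (fun i => S (delta_mx ord0 i : 'rV[R]_n)) => x.
rewrite -[LHS]TK [in LHS](row_sum_delta (T x)) linear_sum.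
by apply: eq_bigr => i _; rewrite linearZ cE.
Qed.

Lemma ultra_fmap (T W : Type) (f : T -> W) (U : set_system T) :
  UltraFilter U -> UltraFilter (f @ U).
Proof.
move=> UU; split=> [|H HF UH]; first exact: fmap_proper_filter.
rewrite eqEsubset; split=> // A HA.
have [//|nA] := in_ultra_setVsetC (f @^-1` A) UU.
by have /filter_ex[w []] : H (A `&` ~` A) by apply: filterI => //; apply: UH.
Qed.

Section LimitProjection.
Context {R : realType} {F : normedModType R} (G : submodClosed F) (n : nat).
Context (c : 'I_n -> Bop (sub_nmod G) R^o) (g : 'I_n -> sub_nmod G).
Context (cgE : forall x, x = \sum_(i < n) (c i x : R) *: g i).

(** Bounded sets of [G] are relatively compact: the coordinates are bounded reals,
    so each of them converges along the ultrafilter. *)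
Lemma ultra_cvg_bounded_sub (I : Type) (U : set_system I) (f : I -> F) (M : R) :
  UltraFilter U -> (\forall s \near U, f s \in G /\ `|f s| <= M) ->
  exists2 l, l \in G & f s @[s --> U] --> l.
Proof.
move=> UU fGM.
pose x s : sub_nmod G := insubd 0 (f s).
have /choice[l lP] (i : 'I_n) : exists l, (c i (x s) : R) @[s --> U] --> (l : R).
  pose h s : R := c i (x s).
  have := @segment_compact R (- (`|c i| * M)) (`|c i| * M).
  rewrite compact_ultra => /(_ (h @ U)).
  case=> [||l [_ hl]]; last by exists l.
    exact: ultra_fmap.
  apply: filterS fGM => s [fG fM]; rewrite /= in_itv/= -ler_norml.
  rewrite (le_trans (ler_normbop (c i) _))// ler_wpM2l//.
  have -> : `|x s| = `|f s| by rewrite -[LHS]/(`|val _|) insubdK.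
  exact: fM.
exists (\sum_(i < n) l i *: val (g i)).
  by apply: rpred_sum => i _; apply: rpredZ; case: (g i).
apply: cvg_trans (_ : (\sum_(i < n) (c i (x s) : R) *: val (g i)) @[s --> U] --> _).
  apply: near_eq_cvg; near=> s; have [fG fM] : f s \in G /\ `|f s| <= M by near: s.
  have <- : val (x s) = f s by rewrite insubdK.
  rewrite [in RHS](cgE (x s)) linear_sum; apply: eq_bigr => i _.
  by rewrite linearZ.
have := @cvg_big F 'I_n +%R 0 xpredT (@add_continuous F) I U (index_enum 'I_n)
  (fun i s => (c i (x s) : R) *: val (g i)) (fun i => l i *: val (g i)) _.
apply=> i _.
by apply: cvgZr_tmp; exact: lP.
Unshelve. all: by end_near. Qed.

(** Finite subsets of [F] stand for the large subspaces [G'].  Along an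
    ultrafilter containing, for every finite [t], the set of all [s] that contain
    [t], each identity required of the limit holds eventually for [Q s]. *)
Lemma limit_projection (lam : R) : 0 <= lam ->
  (forall s : seq F, exists Q : F -> F,
    [/\ {in s, forall y, Q y \in G},
        {in G, forall y, Q y = y},
        forall a, {in s &, forall x y, Q (a *: x + y) = a *: Q x + Q y} &
        {in s, forall y, `|Q y| <= lam * `|y|}]) ->
  exists P : Bop F F,
    [/\ forall y, P y \in G, {in G, forall y, P y = y} & `|P| <= lam].
Proof.
move=> lam0 /choice[Q QP].
pose B (t : seq F) := [set s : seq F | {subset t <= s}].
have FB : ProperFilter (filter_from setT B).
  apply: filter_from_proper => [|t _]; last by exists t => x.
  apply: filter_from_filter; first by exists [::].
  move=> t t' _ _; exists (t ++ t') => // s tts.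
  by split=> x xt; apply: tts; rewrite mem_cat xt ?orbT.
have [U [UU BU]] := ultraFilterLemma FB.
have Us (y : F) : \forall s \near U, y \in s.
  apply: BU; exists [:: y] => // s; apply; exact: mem_head.
have /choice[P PP] (y : F) : exists l, l \in G /\ Q s y @[s --> U] --> l.
  have [|l] := @ultra_cvg_bounded_sub _ U (Q^~ y) (lam * `|y|) UU; last by exists l.
  by near=> s; have [QG _ _ Ql] := QP s; split; [apply: QG|apply: Ql]; near: s.
have Plin : linear P.
  move=> a x y; apply: (cvg_unique (@norm_hausdorff _ _) (PP _).2).
  apply: cvg_trans (cvgD (cvgZl_tmp (PP x).2) (PP y).2).
  apply: near_eq_cvg; near=> s; have [_ _ Qlin _] := QP s.
  by rewrite /= Qlin//; near: s.
have Ple y : `|P y| <= lam * `|y|.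
  have := @closed_cvg _ R U _ (fun s => `|Q s y|) (fun r => r <= lam * `|y|).
  apply; [exact: closed_le| |exact: cvg_norm (PP y).2].
  by near=> s; have [_ _ _ Ql] := QP s; apply: Ql; near: s.
have [T TE Tle] := bop_of_linear Plin lam0 Ple.
exists T; split=> // y; rewrite TE; first exact: (PP y).1.
move=> yG; apply: (cvg_unique (@norm_hausdorff _ _) (PP y).2) => /=.
apply: cvg_near_cst; near=> s.
by have [_ Qid _ _] := QP s; rewrite Qid.
Unshelve. all: by end_near. Qed.

End LimitProjection.

(** The representation by bounded functionals [c] and vectors [g] is what is later
    approximated by countably many operators. *)
Lemma finite_rank_projection (R : realType) (p : R) (p1 : 1 < p) (C rp : R)
    (Gamma : R -> R) (F : normedModType R) (eta rho : R) :
  1 <= C -> Lp_plus_space p1 C F -> stability_pair p1 rp Gamma ->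
  0 < eta -> (C + eta) ^+ 2 < rho -> rho < rp ->
  forall y0 : F, exists (P : Bop F F) (n : nat) (c : 'I_n -> Bop F R^o)
      (g : 'I_n -> F),
    [/\ forall y, P y = \sum_(i < n) (c i y : R) *: g i,
        forall y, P (P y) = P y, P y0 = y0 &
        `|P| <= (C + eta) * Gamma rho].
Proof.
move=> C1 FLp stab eta0 krho rhorp y0.
have k1 : 1 <= C + eta by rewrite (le_trans C1)// lerDl ltW.
have Gamma0 : 0 <= Gamma rho.
  have [_ Gamma1 _ _ _] := stab; rewrite (le_trans ler01)// Gamma1// in_itv/=.
  by rewrite rhorp andbT (le_trans _ (ltW krho))// exprn_ege1.
have [G [n [y0G _ /[dup] Gn /d_BM_lt[T [S [TK _ _]]]]]] :=
  FLp eta _ eta0 (finite_dim_lin_span [:: y0]).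
have [c [g cg]] := ellp_coordinates TK.
have [|s|P [PG Pid Ple]] := limit_projection cg (lam := (C + eta) * Gamma rho).
- by rewrite mulr_ge0// (le_trans ler01).
- have [G' [N [GG' _ G'N]]] := FLp eta _ eta0
    (finite_dim_lin_span ([seq val (g i) | i <- enum 'I_n] ++ s)).
  have GsubG' : {subset G <= G'}.
    move=> y yG; rewrite (_ : y = val (SubNmod yG))// (cg (SubNmod yG)).
    rewrite linear_sum rpred_sum// => i _; rewrite linearZ rpredZ// GG'//.
    by rewrite mem_lin_span// mem_cat (map_f (fun i => val (g i)))// mem_enum.
  have sG' : {subset s <= G'}.
    by move=> y ys; rewrite GG'// mem_lin_span// mem_cat ys orbT.
  have [Q [QG Qid Qlin Qle]] := local_projection stab GsubG' k1 krho rhorp Gn G'N.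
  exists Q; split=> // [y /sG'|a x y /sG' xG' /sG'|y /sG'].
  + exact: QG.
  + exact: Qlin.
  + exact: Qle.
pose PG' y : sub_nmod G := SubNmod (PG y).
have [PB PBE _] : exists2 PB : Bop F (sub_nmod G), (forall y, PB y = PG' y) &
    `|PB| <= `|P|.
  apply: bop_of_linear => // [a x y|y]; last exact: (ler_normbop P y).
  by apply: val_inj; rewrite /= linearP.
exists P, n, (fun i => bop_comp (c i) PB), (fun i => val (g i)); split=> //.
- move=> y; rewrite (_ : P y = val (PG' y))// (cg (PG' y)) linear_sum.
  by apply: eq_bigr => i _; rewrite linearZ/= PBE.
- by move=> y; rewrite Pid.
- by apply: Pid; apply: y0G; rewrite mem_lin_span ?mem_head.
Qed.

(** * Uniform convexity and projections of norm close to one *)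

Lemma convexity_modulus_le (R : realType) (F : normedModType R) (eta : R)
    (x y : F) : `|x| <= 1 -> `|y| <= 1 -> eta <= `|x - y| ->
  (convexity_modulus F eta <= (1 - `|2^-1 *: (x + y)|)%:E)%E.
Proof. by move=> x1 y1 xy; apply: ereal_inf_lbound; exists (x, y). Qed.

(** Compare two opposite unit vectors. *)
Lemma convexity_modulus_le1 (R : realType) (F : normedModType R) (eta : R)
    (x : F) : x != 0 -> eta <= 2 -> (convexity_modulus F eta <= 1%:E)%E.
Proof.
move=> x0 eta2; have u1 : `| `|x|^-1 *: x| = 1 by rewrite normfZV.
apply: le_trans (@convexity_modulus_le _ _ _ (`|x|^-1 *: x) (- (`|x|^-1 *: x)) _ _ _) _.
- by rewrite u1.
- by rewrite normrN u1.
- by rewrite opprK -mulr2n normrMn u1.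
- by rewrite subrr scaler0 normr0 subr0.
Qed.

(** The distances of [y] to [z = P y / (1 + a)] below and above [eta] are treated
    separately.  In the first case
    [|y - s P y| <= eta + (s - 1 / (1 + a)) |P y| <= eta + s (1 + a) - 1]; in the
    second one convexity gives [|P y| <= 1 - 2 t], whence
    [|y - s P y| <= 1 + s (1 - 2 t) = s - 1] as [s = 1 / t].  A nonzero vector
    bounds the modulus by [1], so that [t <= 1]. *)
Lemma uniformly_convex_reflection (R : realType) (F : normedModType R)
    (P : Bop F F) (eta t a : R) (x0 : F) :
  x0 != 0 ->
  (forall y, P (P y) = P y) -> `|P| <= 1 + a -> 0 <= a ->
  0 < eta < 1 -> 0 < t -> (t%:E < convexity_modulus F eta * (4^-1)%:E)%E ->
  (a%:E <= alpha_cst F eta t)%E ->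
  forall y, `|y| <= 1 -> `|y - t^-1 *: P y| <= t^-1 - (1 - eta) / 2.
Proof.
move=> x00 PP Pa a0 /andP[eta0 eta1] t0; rewrite /alpha_cst.
have : (convexity_modulus F eta <= 1%:E)%E.
  by apply: (convexity_modulus_le1 x00); lra.
have := @convexity_modulus_le _ F eta.
case: (convexity_modulus F eta) => [D| |]//; last first.
  by move=> _ _; rewrite mulNyr gtr0_sg ?invr_gt0// mul1e.
move=> Dmid; rewrite lee_fin => D1.
rewrite -!EFinM -EFinB lte_fin !le_min !lee_fin => tD /and3P[_ aD at_] y y1.
have tV0 : 0 < t^-1 by rewrite invr_gt0.
have a1 : 0 < 1 + a by lra.
have lV0 : 0 < (1 + a)^-1 by rewrite invr_gt0.
have lV : (1 + a) * (1 + a)^-1 = 1 by rewrite mulfV ?gt_eqF.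
have Pz (z : F) : `|P z| <= (1 + a) * `|z|.
  by rewrite (le_trans (ler_normbop P z))// ler_wpM2r.
have Py1 : `|P y| <= 1 + a by rewrite (le_trans (Pz y))// ler_piMr// ltW.
pose z := (1 + a)^-1 *: P y.
have z1 : `|z| <= 1.
  by rewrite normrZ (ger0_norm (ltW lV0)) [leLHS]mulrC ler_pdivrMr// mul1r.
have [near_z|far_z] := ltP `|y - z| eta.
  have -> : y - t^-1 *: P y = (y - z) - (t^-1 - (1 + a)^-1) *: P y.
    by rewrite scalerBl opprB addrA subrK.
  have lt : (1 + a)^-1 <= t^-1 by rewrite lef_pV2 ?posrE//; lra.
  have sa : t^-1 * a <= (1 - eta) / 2.
    by rewrite [leLHS]mulrC ler_pdivrMr//; lra.
  rewrite (le_trans (ler_normB _ _))// normrZ ger0_norm ?subr_ge0//.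
  have : (t^-1 - (1 + a)^-1) * `|P y| <= t^-1 + t^-1 * a - 1.
    rewrite (le_trans (ler_wpM2l _ Py1)) ?subr_ge0// mulrBl mulrDr mulr1.
    by rewrite (mulrC _^-1 (1 + a)) lV.
  lra.
have mid := Dmid _ _ y1 z1 far_z; rewrite lee_fin in mid.
have midP : P (2^-1 *: (y + z)) = (2^-1 * (1 + (1 + a)^-1)) *: P y.
  by rewrite linearZ linearD linearZ /= PP -[X in X + _]scale1r -scalerDl scalerA.
have Pmid : 2^-1 * (1 + (1 + a)^-1) * `|P y| <= (1 + a) * (1 - D).
  have c0 : 0 <= 2^-1 * (1 + (1 + a)^-1) by lra.
  rewrite -[X in X * _](ger0_norm c0) -normrZ -midP.
  by rewrite (le_trans (Pz _))// ler_pM2l//; lra.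
(* Multiplying by 2 (1 + a), the bound reads (2 + a) |P y| <= 2 (1 + a)^2 (1 - D),
   and 2 (1 + a)^2 <= (2 + a) (1 + 2 a); finally
   (1 + 2 a) (1 - D) <= 1 + 2 a - D <= 1 - 2 t. *)
have Py : `|P y| <= 1 - 2 * t.
  have Pmid' : (2 + a) * `|P y| <= 2 * (1 + a) ^+ 2 * (1 - D).
    have := ler_wpM2l (ltW a1) Pmid.
    have -> : (1 + a) * (2^-1 * (1 + (1 + a)^-1) * `|P y|) =
        2^-1 * ((1 + a) + (1 + a) * (1 + a)^-1) * `|P y| by ring.
    rewrite lV => h; lra.
  have a2 : 0 < 2 + a by lra.
  rewrite -(ler_pM2l a2) (le_trans Pmid')//; nra.
rewrite (le_trans (ler_normB _ _))// normrZ gtr0_norm//.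
have : t^-1 * `|P y| <= t^-1 - 2.
  by rewrite [leLHS]mulrC ler_pdivrMr// mulrBl mulVf ?gt_eqF.
lra.
Qed.

(** * A countable dense family of finite-rank operators *)

Lemma separable_dense_seq (R : realType) (X : normedModType R) :
  separable_space X ->
  exists a : nat -> X, forall x (eps : R), 0 < eps -> exists n, `|x - a n| < eps.
Proof.
move=> [A /countable_injP[f finj] Adense].
have /choice[a aP] (n : nat) : exists x, (exists2 y, A y & f y = n) -> A x /\ f x = n.
  have [[y Ay fy]|no] := pselect (exists2 y, A y & f y = n); first by exists y.
  by exists 0 => /no.
exists a => x eps eps0.
have [||y [xy Ay]] := Adense (ball x eps).
- by exists x; exact: ballxx.
- exact: ball_open.
- have [|Aa fa] := aP (f y); first by exists y.
  exists (f y); rewrite (finj _ _ _ _ fa) ?inE//.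
  by move: xy; rewrite -ball_normE.
Qed.

Section TensorSums.
Context {R : realType} {E F : normedModType R}.

Lemma rank_one_finite_rank (f : Bop E R^o) (y : F) :
  f != 0 -> finite_rank (rank_one f y).
Proof.
move=> f0.
have [x fx0] : exists x, (f x : R) != 0.
  apply: contrapT => nf; move/eqP: f0; apply; apply: bopP => x.
  by apply/eqP; apply: contrapT => /negP fx; apply: nf; exists x.
have mem (v : 'rV[R]_1) : v ord0 ord0 *: y \in bop_range (rank_one f y).
  rewrite inE/=; exists ((v ord0 ord0 / f x) *: x) => //=.
  by rewrite linearZ /= -[_ *: (f x)]/(_ * _) mulfVK.
apply: (@finite_dim_surj _ _ 1 (fun v => SubNmod (mem v))).
  by move=> a u v; apply: val_inj; rewrite /= !mxE scalerDl scalerA.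
move=> [z zP]; have /set_mem[u _ uz] := zP; exists (\row_(j < 1) (f u : R)).
by apply: val_inj; rewrite /= mxE.
Qed.

Context (a : nat -> Bop E R^o) (b : nat -> F).

Definition tensor_sum (s : seq (nat * nat)) : Bop E F :=
  \sum_(ij <- s) rank_one (a ij.1) (b ij.2).

(** Each term has rank at most one, and the subspace [Z] is closed under sums. *)
Lemma tensor_sum_mem (Z : submodClosed (Bop E F)) :
  (forall T : Bop E F, finite_rank T -> T \in Z) -> forall s, tensor_sum s \in Z.
Proof.
move=> fr s; apply: rpred_sum => ij _; have [->|a0] := eqVneq (a ij.1) 0.
  rewrite (_ : rank_one _ _ = 0) ?rpred0//.
  by apply: bopP => x /=; rewrite scale0r.
exact/fr/rank_one_finite_rank.
Qed.

Context (a_dense : forall f (eps : R), 0 < eps -> exists n, `|f - a n| < eps).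
Context (b_dense : forall y (eps : R), 0 < eps -> exists n, `|y - b n| < eps).

(** [f (x) y - a_i (x) b_j = f (x) (y - b_j) + (f - a_i) (x) b_j]; the vector
    [b_j] is chosen before [a_i], since the second error term depends on it. *)
Lemma rank_one_approx (f : Bop E R^o) (y : F) (eps : R) : 0 < eps ->
  exists i j, `|rank_one f y - rank_one (a i) (b j)| < eps.
Proof.
move=> eps0.
have f1 : 0 < `|f| + 1 by rewrite ltr_wpDl.
have [j yj] := b_dense y (divr_gt0 (divr_gt0 eps0 (ltr0n _ 2)) f1).
have b1 : 0 < `|b j| + 1 by rewrite ltr_wpDl.
have [i fi] := a_dense f (divr_gt0 (divr_gt0 eps0 (ltr0n _ 2)) b1).
exists i, j.
move: yj fi; rewrite !ltr_pdivlMr// => yj fi.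
have : `|rank_one f y - rank_one (a i) (b j)| <=
    `|y - b j| * `|f| + `|f - a i| * `|b j|.
  apply: bop_norm_le; first by rewrite addr_ge0 ?mulr_ge0.
  move=> x; rewrite bopBE /=.
  have -> : (f x : R) *: y - (a i x : R) *: b j =
      (f x : R) *: (y - b j) + (((f - a i) x : R^o) : R) *: b j.
    by rewrite bopBE scalerBr scalerBl addrA subrK.
  rewrite (le_trans (ler_normD _ _))// !normrZ mulrDl lerD//.
    rewrite [leLHS]mulrC -mulrA ler_wpM2l//; exact: (ler_normbop f x).
  rewrite mulrAC ler_wpM2r//; exact: (ler_normbop (f - a i) x).
have := normr_ge0 (y - b j); have := normr_ge0 (f - a i).
move: yj fi; rewrite !mulrDr !mulr1; lra.
Qed.

Lemma tensor_sum_approx (n : nat) (c : 'I_n -> Bop E R^o) (g : 'I_n -> F)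
    (eps : R) : 0 < eps ->
  exists s, `|\sum_(i < n) rank_one (c i) (g i) - tensor_sum s| < eps.
Proof.
elim: n c g eps => [|n IHn] c g eps eps0.
  by exists [::]; rewrite /tensor_sum big_ord0 big_nil subrr normr0.
have e2 : 0 < eps / 2 by rewrite divr_gt0.
have [i [j ij]] := rank_one_approx (c ord0) (g ord0) e2.
have [s sE] := IHn (fun i => c (lift ord0 i)) (fun i => g (lift ord0 i)) _ e2.
exists ((i, j) :: s); rewrite /tensor_sum big_ord_recl big_cons /= opprD addrACA.
by rewrite (le_lt_trans (ler_normD _ _))// [ltRHS](splitr eps) ltrD.
Qed.

End TensorSums.

(** * The centers of the covering balls *)

Lemma norm_almost_attained (R : realType) (E F : normedModType R) (T : Bop E F)
    (M : R) : M < `|T| -> exists2 x, `|x| <= 1 & M < `|T x|.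
Proof.
move=> MT; apply: contrapT => no; move: MT; apply/negP; rewrite -leNgt.
apply: opnorm_le => x x1; rewrite leNgt; apply/negP => MTx.
by apply: no; exists x.
Qed.

(** With [kappa = (1 - e) / 2] and [s = 1 / t], the operator [s P T] is at distance
    at most [s - kappa] from [T].  It has norm at least [s - kappa / 12], and
    replacing it by a tensor sum costs another [kappa / 12], so that radius
    [s - kappa / 2] and norms at least [s - kappa / 4] leave a gap. *)
Lemma tensor_sum_center (R : realType) (p : R) (p1 : 1 < p) (C rp : R)
    (Gamma : R -> R) (E F : normedModType R) (eta rho : R)
    (a : nat -> Bop E R^o) (b : nat -> F) :
  1 <= C -> Lp_plus_space p1 C F -> stability_pair p1 rp Gamma ->
  0 < eta -> (C + eta) ^+ 2 < rho -> rho < rp ->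
  (((C + eta) * Gamma rho)%:E < Lambda_cst F)%E ->
  (forall f (eps : R), 0 < eps -> exists n, `|f - a n| < eps) ->
  (forall y (eps : R), 0 < eps -> exists n, `|y - b n| < eps) ->
  exists r m : R, r < m /\ forall T : Bop E F, `|T| = 1 ->
    exists s, m <= `|tensor_sum a b s| /\ `|T - tensor_sum a b s| < r.
Proof.
move=> C1 FLp stab eta0 krho rhorp lamL a_dense b_dense.
have [_ Gamma1 _ _ _] := stab.
have lam1 : 1 <= (C + eta) * Gamma rho.
  rewrite -[1]mulr1 ler_pM//; first by rewrite (le_trans C1)// lerDl ltW.
  apply: Gamma1; rewrite in_itv/= rhorp andbT (le_trans _ (ltW krho))//.
  by rewrite exprn_ege1// (le_trans C1)// lerDl ltW.
set lam := (C + eta) * Gamma rho in lam1 lamL *.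
have [_ [e [t [/andP[e0 e1] t0 tD ->]]]] :
    exists2 x, [set x : \bar R | exists eta t : R, [/\ (0 < eta < 1)%R, (0 < t)%R,
      (t%:E < convexity_modulus F eta * (4^-1)%:E)%E & x = alpha_cst F eta t]] x &
      ((lam - 1)%:E < x)%E.
  by apply: ereal_sup_gt; rewrite EFinB lteBlDl.
move=> lamalpha.
pose kappa := (1 - e) / 2.
have kappa0 : 0 < kappa by rewrite divr_gt0// subr_gt0.
exists (t^-1 - kappa / 2), (t^-1 - kappa / 4); split; first by lra.
move=> T T1.
have tV0 : 0 < t^-1 by rewrite invr_gt0.
have tk0 : 0 < t * (kappa / 12) by rewrite mulr_gt0// divr_gt0.
(* The minimum with [1] ensures [T x != 0]. *)
have [|x x1 Tx] := @norm_almost_attained _ _ _ T (1 - Num.min 1 (t * (kappa / 12))).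
  by rewrite T1 gtrBl lt_min tk0 ltr01.
have Tx0 : T x != 0.
  rewrite -normr_gt0 (le_lt_trans _ Tx)// subr_ge0 ge_min lexx//.
have [P [n [c [g [Pcg PP PTx Ple]]]]] :=
  finite_rank_projection C1 FLp stab eta0 krho rhorp (T x).
have refl := @uniformly_convex_reflection _ _ P e t (lam - 1) (T x) Tx0 PP.
have [s sE] := tensor_sum_approx a_dense b_dense
  (fun i => bop_comp (c i) T) (fun i => t^-1 *: g i) (divr_gt0 kappa0 (ltr0n _ 12)).
set S := \sum_(i < n) _ in sE.
have SE z : S z = t^-1 *: P (T z).
  rewrite bop_sumE Pcg scaler_sumr; apply: eq_bigr => i _ /=.
  by rewrite !scalerA mulrC.
have TS : `|T - S| <= t^-1 - kappa.
  apply: opnorm_le => z z1; rewrite bopBE SE; apply: refl.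
  - by rewrite addrC subrK.
  - by rewrite subr_ge0.
  - by rewrite e0.
  - by [].
  - by [].
  - exact: ltW.
  - by rewrite (le_trans (ler_normbop T z))// T1 mul1r.
have Sge : t^-1 - kappa / 12 <= `|S|.
  have : `|S x| <= `|S|.
    by rewrite (le_trans (ler_normbop S x))// ler_piMr.
  rewrite SE PTx normrZ gtr0_norm//; apply: le_trans.
  have : 1 - t * (kappa / 12) <= `|T x|.
    by rewrite (le_trans _ (ltW Tx))// lerB// ge_min lexx orbT.
  move/(ler_wpM2l (ltW tV0)); rewrite mulrBr mulr1 mulrA mulVf ?gt_eqF// mul1r.
  exact: id.
exists s; split.
  have := ler_normD (S - tensor_sum a b s) (tensor_sum a b s); rewrite subrK.
  move: sE Sge; lra.
have := ler_normD (T - S) (S - tensor_sum a b s); rewrite addrA subrK.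
move: sE TS; lra.
Qed.

Theorem corollary1p2 (R : realType) (p : R) (p1 : 1 < p) (C : R)
    (F : completeNormedModType R) (rp : R) (Gamma : R -> R)
    (E : completeNormedModType R) (Z : submodClosed (Bop E F)) :
  1 <= C ->
  separable_space F ->
  uniformly_convex F ->
  Lp_plus_space p1 C F ->
  stability_pair p1 rp Gamma ->
  (exists eta rho : R, [/\ 0 < eta, (C + eta) ^+ 2 < rho, rho < rp &
    (((C + eta) * Gamma rho)%:E < Lambda_cst F)%E]) ->
  separable_space (dual E) ->
  closed [set T : Bop E F | T \in Z] ->
  (forall T : Bop E F, finite_rank T -> T \in Z) ->
  UBCP (sub_nmod Z).
Proof.
move=> C1 Fsep _ FLp stab [eta [rho [eta0 krho rhorp lamL]]] Esep _ Zfr.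
have [a a_dense] := separable_dense_seq Esep.
have [b b_dense] := separable_dense_seq Fsep.
have [r [m [rm cover]]] :=
  tensor_sum_center C1 FLp stab eta0 krho rhorp lamL a_dense b_dense.
have [Z0|/existsNP[w /eqP w0]] := pselect (forall z : sub_nmod Z, z = 0); first by left.
right.
have w1 : `| `|w|^-1 *: w| = 1 by rewrite normfZV.
have [s0 [ms0 rs0]] := cover (`|w|^-1 *: val w) w1.
(* The operators of norm less than [m] are not admissible centers; their indices
   are redirected to the admissible [s0]. *)
pose idx j := let s := odflt s0 (unpickle j) in
  if m <= `|tensor_sum a b s| then s else s0.
exists r, (fun j => SubNmod (tensor_sum_mem a b Zfr (idx j))); split.
- exact: le_lt_trans rs0.
- move=> x /= x1; have [s [ms rs]] := cover (val x) x1.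
  exists (pickle s) => //; rewrite -ball_normE /=.
  rewrite -[X in X < _]/(`|tensor_sum a b (idx (pickle s)) - val x|).
  by rewrite /idx pickleK /= ms distrC.
- apply: (lt_le_trans rm); apply: lb_le_inf; first by eexists; exists 0%N.
  move=> _ [j _ <-]; rewrite -[leRHS]/(`|tensor_sum a b (idx j)|).
  by rewrite /idx; case: ifP.
Qed.
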